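(* Let $w\in\mathbb{R}$ with $w>0$ and let $b,z\in\mathbb{C}$ satisfy $\Re(z)>0$, $\Re(b)>0$ and $\Re(b-z)>0$. Then $$\int_{0}^{\infty}v^{z-1}\,\zeta\!\left(b+1,\,v+w+\tfrac12\right)dv=\frac{\Gamma(z)\,\Gamma(b+1-z)}{\Gamma(b+1)}\;\zeta\!\left(b+1-z,\,w+\tfrac12\right).$$
   Context: $\zeta(s,a)$ is the Hurwitz zeta function, $\zeta(s,a)=\sum_{k=0}^{\infty}1/(k+a)^s$ for $\Re(s)>1$, with $a>0$ here. *)

(* Defs.v *)
(* MathComp-Analysis over an abstract [R : realType], with the complex numbers
   [R[i]] of mathcomp-real-closed. [Re] and [Im] are written [complex.Re] and
   [complex.Im]: the bare names are the projections of a numClosedFieldType,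
   which land in [R[i]] instead of [R]. *)
From HB Require Import structures.
From mathcomp Require Export all_boot all_order all_algebra.
From mathcomp Require Export all_classical all_reals all_analysis.
From mathcomp Require Export complex.

Export Order.TTheory GRing.Theory Num.Theory.
Export numFieldNormedType.Exports.

Set Implicit Arguments.
Unset Strict Implicit.
Unset Printing Implicit Defensive.

Local Open Scope classical_set_scope.
Local Open Scope ring_scope.
Local Open Scope complex_scope.

Definition cexp (R : realType) (s : R[i]) : R[i] :=
  (expR (complex.Re s))%:C * (cos (complex.Im s) +i* sin (complex.Im s)).

(* [x ^ s] for a real base [x > 0], through the real logarithm (the principal
   branch); [ln] is 0 on [x <= 0], so the value there is a dummy. *)
Definition cpow (R : realType) (x : R) (s : R[i]) : R[i] :=
  cexp (s * (ln x)%:C).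

(* Integrability and integral of a complex-valued function, in terms of its
   real and imaginary parts; when [cintegrable] fails, [cintegral] is
   meaningless. *)
Definition cintegrable (d : measure_display) (T : measurableType d)
    (R : realType) (mu : {measure set T -> \bar R}) (D : set T)
    (f : T -> R[i]) : Prop :=
  mu.-integrable D (fun x => (complex.Re (f x))%:E) /\
  mu.-integrable D (fun x => (complex.Im (f x))%:E).

Definition cintegral (d : measure_display) (T : measurableType d)
    (R : realType) (mu : {measure set T -> \bar R}) (D : set T)
    (f : T -> R[i]) : R[i] :=
  (\int[mu]_(x in D) complex.Re (f x))%R +i*
  (\int[mu]_(x in D) complex.Im (f x))%R.

(* Euler's integral: this is the Gamma function on [0 < Re s] only. *)
Definition Gamma (R : realType) (s : R[i]) : R[i] :=
  cintegral lebesgue_measure `]0, +oo[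
    (fun t : R => cpow t (s - 1) * (expR (- t))%:C).

(* The defining series: this is the Hurwitz zeta function on [1 < Re s] only,
   with [0 < a]. The limit is taken in [R[i]] for the topology of its norm,
   which is attached to the alias [R[i]^o]. *)
Definition hurwitz_zeta (R : realType) (s : R[i]) (a : R) : R[i] :=
  limn (series (fun k : nat => (cpow (k%:R + a) s)^-1 : R[i]^o)).

(* Main.v *)
Require Import Defs.
From mathcomp Require Import ring lra measurable_realfun.

(** For [c > 0], Fubini applied to [v^(z-1) t^(s-1) exp(-(v+c)t)] on the
    quadrant gives the Mellin transform
      Gamma s * int v^(z-1) (v+c)^(-s) dv = Gamma z * Gamma (s-z) * c^(z-s).
    Taking [s = b + 1], [c = k + w + 1/2] and summing over [k] (dominated
    convergence) yields the claim once one may divide by [Gamma s].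

    That [Gamma] has no zero with [0 < Re s] comes from [Gamma (s+1) = s Gamma s]:
    a zero at [s] would propagate to all [s + n], while for [p] large compared
    with [q] the Gamma weight [t^(p-1) exp(-t)] concentrates so much around
    [t = p] that [int t^(p-1) exp(-t) cos(q ln (t/p)) dt], a real combination
    of the real and imaginary parts of [Gamma (p + iq)], is positive. *)

(** The modulus of [cexp s] is [expR (Re s)], so a complex kernel is always dominated by the kernel
    of the same shape with real exponents. The Mellin transform therefore serves twice: with [s] and
    [z] for the terms of the series, and with [Re s] and [Re z] for their majorants, whose integrals
    are a constant times [c ^ (Re z - Re s)]. For [c = k + w + 1/2] these are summable in [k]
    exactly when [1 < Re (s - z)], that is [0 < Re (b - z)].

    As [Gamma] is defined by Euler's integral, its nonvanishing is drawn from that integral too.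
    Adding integers to [s] enlarges [p] and leaves [q] alone, so the range where [p] is large is
    always reached. There the cosine is bounded below by a combination of [1], [t / p] and [p / t],
    because these integrate against the weight to values of Gamma at [p], [p + 1] and [p - 1], which
    the functional equation compares. *)

Set Implicit Arguments.
Unset Strict Implicit.
Unset Printing Implicit Defensive.

Local Open Scope classical_set_scope.
Local Open Scope ring_scope.
Local Open Scope complex_scope.

(** * The fundamental theorem of calculus on the open half-line *)

Section PosCalculus.
Context (R : realType).
Local Notation mu := (@lebesgue_measure R).
Local Notation P := (`]0%R, +oo[%classic : set R).
Implicit Types (f F : R -> R).

(** Compact exhaustion of the half-line. The shift to [n.+2] keeps the two endpoints distinct
    already at [n = 0], as the fundamental theorem on a segment requires. *)
Let E (n : nat) : set R := `[(n.+2%:R)^-1, n.+2%:R].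

Let E_pos n x : E n x -> 0 < x.
Proof. by rewrite /E /= in_itv/= => /andP[+ _]; apply: lt_le_trans; rewrite invr_gt0. Qed.

Let E_nd n m : (n <= m)%N -> E n `<=` E m.
Proof.
move=> nm; apply: subset_itv; rewrite bnd_simp.
- by rewrite lef_pV2 ?posrE// ler_nat !ltnS.
- by rewrite ler_nat !ltnS.
Qed.

Let E_cover (x : R) : 0 < x -> \forall n \near \oo, E n x.
Proof.
move=> x0; near=> n; rewrite /E /= in_itv/=; apply/andP; split.
- rewrite -[leRHS]invrK lef_pV2 ?posrE ?invr_gt0//.
  apply: (@le_trans _ _ n%:R); last by rewrite ler_nat -addn2 leq_addr.
  by near: n; exact: nbhs_infty_ger.
- apply: (@le_trans _ _ n%:R); last by rewrite ler_nat -addn2 leq_addr.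
  by near: n; exact: nbhs_infty_ger.
Unshelve. all: by end_near. Qed.

Lemma continuous_measurable_pos f :
  (forall x : R, 0 < x -> {for x, continuous f}) -> measurable_fun P f.
Proof.
move=> cf; apply: open_continuous_measurable_fun => //.
by move=> x; rewrite inE/= in_itv/= andbT; exact: cf.
Qed.

Let FTC_E f F n :
  (forall x : R, 0 < x -> is_derive x 1 F (f x)) ->
  (forall x : R, 0 < x -> {for x, continuous f}) ->
  (\int[mu]_(x in E n) (f x)%:E = (F n.+2%:R - F (n.+2%:R)^-1)%:E)%E.
Proof.
move=> dF cf.
have cF x : 0 < x -> {for x, continuous F}.
  move=> x0; apply: differentiable_continuous; apply/derivable1_diffP.
  exact: (@ex_derive _ _ _ _ _ _ _ (dF x x0)).
have n1 : (n.+2%:R : R)^-1 < n.+2%:R.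
  by apply: (@lt_trans _ _ 1); [rewrite invf_lt1 ?ltr1n|rewrite ltr1n].
rewrite (@continuous_FTC2 _ f F)//.
- apply: continuous_in_subspaceT => x; rewrite inE/= => Ex; apply: cf.
  exact: (@E_pos n).
- split.
  + move=> x; rewrite in_itv/= => /andP[ax _].
    apply: (@ex_derive _ _ _ _ _ _ _ (dF x _)); apply: lt_trans ax.
    by rewrite invr_gt0.
  + by apply: cvg_at_right_filter; apply: cF; rewrite invr_gt0.
  + by apply: cvg_at_left_filter; apply: cF.
- move=> x; rewrite in_itv/= => /andP[ax _].
  rewrite derive1E; apply: derive_val; apply: dF; apply: lt_trans ax.
  by rewrite invr_gt0.
Qed.

(** Monotone convergence along the exhaustion: each segment contributes a difference of two values
    of [F] in [[0, M]]. This is the source of integrability when no integral is known to be finite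
    yet. *)
Lemma FTC_pos_ge0 f F (M : R) :
  (forall x : R, 0 < x -> is_derive x 1 F (f x)) ->
  (forall x : R, 0 < x -> {for x, continuous f}) ->
  (forall x, 0 < x -> 0 <= f x) ->
  (forall x, 0 < x -> 0 <= F x <= M) ->
  (\int[mu]_(x in P) (f x)%:E <= M%:E)%E.
Proof.
move=> dF cf f0 FM.
have UE : \bigcup_n E n = P.
  apply/seteqP; split=> [x [n _ /E_pos x0]|x]; rewrite /= in_itv/= andbT//.
  by move=> /E_cover[n _ En]; exists n => //; apply: En => /=.
rewrite -UE.
have ndE : nondecreasing_seq E by move=> n m nm; apply/subsetPset; exact: E_nd.
have mE n : measurable (E n) by exact: measurable_itv.
have mfE n : measurable_fun (E n) (EFin \o f).
  apply/measurable_EFinP; apply: (measurable_funS _ _ (continuous_measurable_pos cf)) => //.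
  by move=> x /E_pos; rewrite /= in_itv/= andbT.
have fE0 n x : E n x -> (0 <= (EFin \o f) x)%E by move=> /E_pos/f0; rewrite lee_fin.
have cv := @ge0_nondecreasing_set_cvg_integral _ (measurableTypeR R) R E _ mu ndE mE mfE fE0.
rewrite -(cvg_lim _ cv)//.
apply: lime_le; first by apply/cvg_ex; exists (\int[mu]_(x in \bigcup_i E i) (EFin \o f) x)%E.
apply: nearW => n; rewrite FTC_E// lee_fin.
have /andP[_ h1] := FM n.+2%:R (ltr0Sn _ _).
have /andP[h2 _] : 0 <= F (n.+2%:R)^-1 <= M by apply: FM; rewrite invr_gt0.
lra.
Qed.

(** Dominated convergence with [|f|] itself as majorant: the truncations of [f] to the segments are
    eventually constant at each point. *)
Lemma FTC_pos f F (l0 l1 : R) :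
  mu.-integrable P (EFin \o f) ->
  (forall x : R, 0 < x -> is_derive x 1 F (f x)) ->
  (forall x : R, 0 < x -> {for x, continuous f}) ->
  F x @[x --> 0^'+] --> l0 -> F x @[x --> +oo] --> l1 ->
  \int[mu]_(x in P) f x = l1 - l0.
Proof.
move=> intf dF cf F0 Fy.
have mP : measurable P by exact: measurable_itv.
have mfP : measurable_fun P (EFin \o f) by exact: measurable_int intf.
pose f_ n := (EFin \o f) \_ (E n).
have mE n : measurable (E n) by exact: measurable_itv.
have EP n : E n `<=` P by move=> x /E_pos; rewrite /= in_itv/= andbT.
have mf_ n : measurable_fun P (f_ n).
  apply/(measurable_restrict _ (mE n) mP).
  by apply: measurable_funS mfP => //; exact: subIsetl.
have f_f : {ae mu, forall x, P x -> f_ ^~ x @ \oo --> (EFin \o f) x}.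
  apply/aeW => x; rewrite /= in_itv/= andbT => x0.
  apply: cvg_near_cst; have := E_cover x0; apply: filterS => n En.
  by rewrite /f_ patchE mem_set.
have ig : mu.-integrable P (abse \o (EFin \o f)) by exact/integrable_abse.
have fg : {ae mu, forall x n, P x -> (`|f_ n x| <= (abse \o (EFin \o f)) x)%E}.
  apply/aeW => x n _; rewrite /f_ patchE; case: ifP => _ //=.
  by rewrite normr0 lee_fin.
have [_ _ cv] :=
  @dominated_convergence _ (measurableTypeR R) R mu P mP f_ _ _ mf_ mfP f_f ig fg.
apply/EFin_inj; rewrite /Rintegral fineK; last exact: integrable_fin_num.
rewrite -(cvg_lim _ cv)//=.
under eq_fun => n.
  rewrite -integral_mkcondr (_ : P `&` E n = E n); last exact/setIidPr/EP.
  rewrite FTC_E//; over.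
have ny : (n.+2%:R : R) @[n --> \oo] --> +oo.
  by apply/cvgryPge => A; near=> n; rewrite (@le_trans _ _ n%:R)//;
    [near: n; exact: nbhs_infty_ger|rewrite ler_nat -addn2 leq_addr].
apply/cvg_lim => //; apply: cvg_EFin; first exact: nearW.
apply: cvgB.
  exact: (cvg_comp _ _ ny Fy).
have /cvg_at_rightP := F0; apply; split; first by move=> n; rewrite invr_gt0.
by apply/gtr0_cvgV0 => //; apply: nearW.
Unshelve. all: by end_near. Qed.

End PosCalculus.

(** * Algebra of the complex exponential and of powers with real base *)

Section ComplexPower.
Context (R : realType).
Implicit Types (s t : R[i]) (x y : R).

Lemma ReM s t : complex.Re (s * t) =
  complex.Re s * complex.Re t - complex.Im s * complex.Im t.
Proof. by case: s t => ? ? []. Qed.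

Lemma ImM s t : complex.Im (s * t) =
  complex.Re s * complex.Im t + complex.Im s * complex.Re t.
Proof. by case: s t => ? ? []. Qed.

Lemma cexpD s t : cexp (s + t) = cexp s * cexp t.
Proof.
case: s t => [a b] [c d]; rewrite /cexp /= expRD cosD sinD.
apply/eqP; rewrite eq_complex /=; apply/andP; split; apply/eqP; ring.
Qed.

Lemma cexpr x : cexp x%:C = (expR x)%:C.
Proof.
by rewrite /cexp /= cos0 sin0; apply/eqP; rewrite eq_complex/=; apply/andP; split; apply/eqP; ring.
Qed.

Lemma Re_cexp s : complex.Re (cexp s) = expR (complex.Re s) * cos (complex.Im s).
Proof. by rewrite /cexp /= mul0r subr0. Qed.

Lemma Im_cexp s : complex.Im (cexp s) = expR (complex.Re s) * sin (complex.Im s).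
Proof. by rewrite /cexp /= mul0r addr0. Qed.

Lemma cexp_neq0 s : cexp s != 0.
Proof.
apply/eqP => s0; have := cexpD s (- s); rewrite s0 mul0r subrr.
by rewrite (_ : 0 = 0%:C)// cexpr expR0 => /eqP; rewrite oner_eq0.
Qed.

Lemma cexpN s : cexp (- s) = (cexp s)^-1.
Proof.
apply: (mulfI (cexp_neq0 s)); rewrite mulfV ?cexp_neq0// -cexpD subrr.
by rewrite (_ : 0 = 0%:C)// cexpr expR0.
Qed.

Lemma cpowD x s t : cpow x (s + t) = cpow x s * cpow x t.
Proof. by rewrite /cpow mulrDl cexpD. Qed.

Lemma cpowN x s : cpow x (- s) = (cpow x s)^-1.
Proof. by rewrite /cpow mulNr cexpN. Qed.

Lemma cpowM x y s : 0 < x -> 0 < y -> cpow (x * y) s = cpow x s * cpow y s.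
Proof. by move=> x0 y0; rewrite /cpow lnM// rmorphD mulrDr cexpD. Qed.

Lemma cpow1 x : 0 < x -> cpow x 1 = x%:C.
Proof. by move=> x0; rewrite /cpow mul1r cexpr lnK. Qed.

Lemma cpow_neq0 x s : cpow x s != 0.
Proof. exact: cexp_neq0. Qed.

Lemma cpow_re x y : cpow x y%:C = (expR (y * ln x))%:C.
Proof. by rewrite /cpow -rmorphM cexpr. Qed.

End ComplexPower.

(** * Linearity and domination for integrals of complex-valued functions *)

Section ComplexIntegral.
Context d (T : measurableType d) (R : realType) (mu : {measure set T -> \bar R}).
Variables (D : set T) (mD : measurable D).
Implicit Types (f g : T -> R[i]).

Lemma eq_cintegrable f g : {in D, f =1 g} ->
  cintegrable mu D f -> cintegrable mu D g.
Proof.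
by move=> fg [h1 h2]; split; [move: h1|move: h2]; apply: eq_integrable => // x xD;
  rewrite fg.
Qed.

Lemma eq_cintegral f g : {in D, f =1 g} -> cintegral mu D f = cintegral mu D g.
Proof.
by move=> fg; rewrite /cintegral; congr (_ +i* _); apply: eq_Rintegral => x xD;
  rewrite fg.
Qed.

Lemma cintegrableZl (k : R[i]) f : cintegrable mu D f ->
  cintegrable mu D (fun x => k * f x).
Proof.
move=> [h1 h2]; split.
- by under eq_fun do rewrite ReM EFinB !EFinM; apply: integrableB => //; exact: integrableZl.
- by under eq_fun do rewrite ImM EFinD !EFinM; apply: integrableD => //; exact: integrableZl.
Qed.

Lemma cintegralZl (k : R[i]) f : cintegrable mu D f ->
  cintegral mu D (fun x => k * f x) = k * cintegral mu D f.
Proof.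
move=> [h1 h2]; rewrite /cintegral.
under eq_Rintegral do rewrite ReM.
rewrite RintegralB//; [|exact: (integrableZl mD _ h1)|exact: (integrableZl mD _ h2)].
rewrite !RintegralZl//.
under [X in _ +i* X]eq_Rintegral do rewrite ImM.
rewrite RintegralD//; [|exact: (integrableZl mD _ h2)|exact: (integrableZl mD _ h1)].
by rewrite !RintegralZl//; case: k.
Qed.

Lemma cintegrableB f g : cintegrable mu D f -> cintegrable mu D g ->
  cintegrable mu D (fun x => f x - g x).
Proof.
move=> [f1 f2] [g1 g2]; split.
- by under eq_fun do rewrite raddfB/= EFinB; exact: integrableB.
- by under eq_fun do rewrite raddfB/= EFinB; exact: integrableB.
Qed.

Lemma cintegralB f g : cintegrable mu D f -> cintegrable mu D g ->
  cintegral mu D (fun x => f x - g x) = cintegral mu D f - cintegral mu D g.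
Proof.
move=> [f1 f2] [g1 g2]; rewrite /cintegral.
under eq_Rintegral do rewrite raddfB/=.
rewrite RintegralB//.
under [X in _ +i* X]eq_Rintegral do rewrite raddfB/=.
by rewrite RintegralB.
Qed.

(** Both components are bounded by the modulus of [cexp (s x)], which is [expR (Re (s x))]. *)
Lemma cintegrable_cexp (s : T -> R[i]) :
  measurable_fun D (fun x => complex.Re (s x)) ->
  measurable_fun D (fun x => complex.Im (s x)) ->
  mu.-integrable D (fun x => (expR (complex.Re (s x)))%:E) ->
  cintegrable mu D (fun x => cexp (s x)).
Proof.
move=> mr mi intE; split.
- apply: le_integrable (intE) => //.
    apply/measurable_EFinP; under eq_fun do rewrite Re_cexp.
    apply: measurable_funM; first exact: measurableT_comp.
    apply: measurableT_comp mi; apply: continuous_measurable_fun.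
    exact: continuous_cos.
  by move=> x _; rewrite lee_fin Re_cexp normrM ler_piMr// cos_max.
- apply: le_integrable (intE) => //.
    apply/measurable_EFinP; under eq_fun do rewrite Im_cexp.
    apply: measurable_funM; first exact: measurableT_comp.
    apply: measurableT_comp mi; apply: continuous_measurable_fun.
    exact: continuous_sin.
  by move=> x _; rewrite lee_fin Im_cexp normrM ler_piMr// sin_max.
Qed.

End ComplexIntegral.

(** * Dilations of the half-line and the kernel of the Gamma integral *)

Section GammaKernel.
Context (R : realType).
Local Notation mu := (@lebesgue_measure R).
Local Notation P := (`]0%R, +oo[%classic : set R).
Implicit Types (s : R[i]) (a c t x : R).

Let mP : measurable (P : set (measurableTypeR R)).
Proof. exact: measurable_itv. Qed.

(** Uniqueness of Lebesgue measure: [c] times its image under [x -> c * x] gives every []a, b]] the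
    mass [b - a]. The half-line is its own preimage under this dilation. *)
Lemma ge0_integral_pos_scale (c : R) (f : R -> \bar R) : 0 < c ->
  measurable_fun setT f -> (forall x, 0 <= f x)%E ->
  (\int[mu]_(x in P) f x = c%:E * \int[mu]_(x in P) f (c * x)%R)%E.
Proof.
move=> c0 mf f0.
pose phi : R -> measurableTypeR R := fun x => c * x.
have mphi : measurable_fun (setT : set (measurableTypeR R)) phi by exact: mulrl_measurable.
pose nu := mscale (NngNum (ltW c0)) (pushforward mu phi).
have mscale_eq A : measurable A -> mu A = nu mphi A.
  move=> mA; apply: lebesgue_measure_unique => //= _ [[a b]] _ <-.
  rewrite /nu /mscale/= /pushforward.
  have -> : phi @^-1` `]a, b] = `]c^-1 * a, c^-1 * b]%classic.
    by apply/seteqP; split => x; rewrite /phi/= !in_itv/= ler_pdivlMl// ltr_pdivrMl//.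
  rewrite !lebesgue_measure_itv/= !lte_fin ltr_pM2l ?invr_gt0//.
  case: ifPn => _; last by rewrite mule0.
  by rewrite -!EFinB -EFinM -mulrBr mulrA mulfV ?mul1r ?gt_eqF.
transitivity (\int[nu mphi]_(x in P) f x)%E.
  by apply: eq_measure_integral => A mA _; exact: mscale_eq.
rewrite ge0_integral_mscale//=; last exact: measurable_funS mf.
rewrite ge0_integral_pushforward//=; last exact: measurable_funS mf.
congr (_ * _)%E; congr integral.
by apply/seteqP; split => x; rewrite /phi/= !in_itv/= !andbT pmulr_rgt0.
Qed.

Lemma Rintegral_pos_scale (c : R) (f : R -> R) : 0 < c ->
  measurable_fun setT f ->
  \int[mu]_(x in P) f (c * x)%R = c^-1 * \int[mu]_(x in P) f x.
Proof.
move=> c0 mf; rewrite /Rintegral.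
have mEf : measurable_fun setT (EFin \o f) by exact/measurable_EFinP.
rewrite [in LHS]integralE [in RHS]integralE.
rewrite (ge0_integral_pos_scale c0 (measurable_funepos mEf))//.
rewrite (ge0_integral_pos_scale c0 (measurable_funeneg mEf))//.
have fE (h : R -> \bar R) (g : R -> \bar R) : (forall x, h (c * x) = g x) ->
    (\int[mu]_(x in P) h (c * x)%R = \int[mu]_(x in P) g x)%E.
  by move=> hg; apply: eq_integral => x _; rewrite hg.
rewrite (fE _ (fun x => (f (c * x))%:E)^\+%E)//.
rewrite (fE _ (fun x => (f (c * x))%:E)^\-%E)//.
set A := integral _ _ _; set B := integral _ _ _.
have A0 : (0 <= A)%E by exact: integral_ge0.
have B0 : (0 <= B)%E by exact: integral_ge0.
have c1 : c^-1 * c = 1 by rewrite mulVf ?gt_eqF.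
(* If [A] or [B] is infinite, [fine] returns 0 on both sides, so the identity covers non-integrable
   [f] as well. *)
case: A A0 => [a| |]// _; case: B B0 => [b| |]// _; rewrite ?gt0_muley ?lte_fin//=.
- by rewrite -mulrBr mulrA c1 mul1r.
- by rewrite mulr0.
- by rewrite mulr0.
- by rewrite mulr0.
- by move=> x; rewrite !funenegE.
- by move=> x; rewrite !funeposE.
Qed.

Lemma mem_pos (x : R) : x \in P -> 0 < x.
Proof. by rewrite inE /= in_itv/= andbT. Qed.

(** Concavity of [ln]: the right-hand side is the tangent line to [p * ln t] at [t = p / c], where
    [p * ln t - c * t] is largest. *)
Lemma ln_le_affine p c t : 0 < p -> 0 < c -> 0 < t ->
  p * ln t <= p * ln (p / c) - p + c * t.
Proof.
move=> p0 c0 t0; have pc : 0 < p / c by exact: divr_gt0.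
have u0 : 0 < t / (p / c) by exact: divr_gt0.
have : ln (1 + (t / (p / c) - 1)) <= t / (p / c) - 1 by apply: le_ln1Dx; lra.
rewrite addrC subrK ln_div ?posrE// => h.
have : p * (ln t - ln (p / c)) <= p * (t / (p / c) - 1) by rewrite ler_pM2l.
rewrite (_ : p * (t / (p / c) - 1) = c * t - p); last first.
  by field; rewrite ?gt_eqF.
lra.
Qed.

Lemma measurable_expR_ln a c :
  measurable_fun setT (fun t : R => expR (a * ln t - c * t)).
Proof.
apply: measurableT_comp => //; apply: measurable_funB.
  by apply: measurable_funM => //; exact: measurable_ln.
exact: measurable_funM.
Qed.

Lemma integrable_expR_ln a c : -1 < a -> 0 < c ->
  mu.-integrable P (fun t => (expR (a * ln t - c * t))%:E).
Proof.
move=> a1 c0; have p1 : 0 < a + 1 by lra.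
(* The integrand is dominated by a multiple of the derivative of
   [(t / (1 + t))^(a + 1)], which is bounded. *)
pose h (t : R) : R := (a + 1) * (ln t - ln (1 + t)).
pose F (t : R) : R := expR (h t).
pose f (t : R) : R := F t * ((a + 1) * (t^-1 - (1 + t)^-1)).
(* Since [f t] is [(a + 1) * t ^ a * (1 + t) ^ (- q)], the domination amounts to
   [(1 + t) ^ q <= expR (K + c * t)], which is [ln_le_affine] taken at [1 + t]. *)
pose q : R := a + 2.
pose K : R := q * ln (q / c) - q + c.
have q0 : 0 < q by rewrite /q; lra.
have lnc (t : R) : 0 < t -> {for t, continuous (fun u : R => ln (1 + u))}.
  move=> t0; apply: (@continuous_comp _ _ _ (fun u : R => 1 + u) (@ln R)).
    by apply: cvgD; [exact: cvg_cst|exact: cvg_id].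
  by apply: continuous_ln; lra.
have hc (t : R) : 0 < t -> {for t, continuous h}.
  move=> t0; apply: continuousM; first exact: cst_continuous.
  by apply: continuousB; [exact: continuous_ln|exact: lnc].
have dF (t : R) : 0 < t -> is_derive t 1 F (f t).
  move=> t0.
  have dl : is_derive t 1 (fun u : R => ln (1 + u)) (1 + t)^-1.
    have t1 : 0 < 1 + t by lra.
    have d1 : is_derive t 1 (cst 1 + id : R -> R) (0 + 1) by exact: is_deriveD.
    have dln : is_derive ((cst 1 + id : R -> R) t) 1 (@ln R) (1 + t)^-1.
      exact: is_derive1_ln.
    by have := is_derive1_comp dln d1; rewrite add0r mulr1.
  have dh : is_derive t 1 h ((a + 1) * (t^-1 - (1 + t)^-1)).
    exact: (is_deriveZ (a + 1) (is_deriveB (is_derive1_ln t0) dl)).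
  exact: (is_derive1_comp (is_derive_expR (h t)) dh).
have cf (t : R) : 0 < t -> {for t, continuous f}.
  move=> t0; apply: continuousM.
    apply: (@continuous_comp _ _ _ h (@expR R)); first exact: hc.
    exact: continuous_expR.
  apply: continuousM; first exact: cst_continuous.
  apply: continuousB; first by apply: continuousV => //; rewrite gt_eqF.
  apply: continuousV; first by rewrite gt_eqF//; lra.
  by apply: cvgD; [exact: cvg_cst|exact: cvg_id].
have fE t : 0 < t -> f t = (a + 1) * expR (a * ln t - (a + 2) * ln (1 + t)).
  move=> t0; have t1 : 0 < 1 + t by lra.
  have -> : a * ln t - (a + 2) * ln (1 + t) = h t - ln t - ln (1 + t).
    by rewrite /h; ring.
  rewrite /f /F !expRB !lnK ?posrE//.
  by field; rewrite !gt_eqF.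
have f0 t : 0 < t -> 0 <= f t.
  by move=> t0; rewrite fE// mulr_ge0 ?expR_ge0//; lra.
have FM t : 0 < t -> 0 <= F t <= 1.
  move=> t0; rewrite /F expR_ge0/= expR_le1 /h.
  rewrite pmulr_rle0// subr_le0 ler_ln ?posrE//; lra.
have intf : mu.-integrable P (EFin \o f).
  apply/integrableP; split.
    by apply/measurable_EFinP; exact: continuous_measurable_pos.
  have -> : (\int[mu]_(x in P) `|(EFin \o f) x| = \int[mu]_(x in P) (f x)%:E)%E.
    by apply: eq_integral => t /mem_pos t0; rewrite /= ger0_norm ?f0.
  exact: le_lt_trans (FTC_pos_ge0 dF cf f0 FM) (ltry _).
have : mu.-integrable P (fun t => ((expR K / (a + 1))%:E * (f t)%:E)%E).
  exact: integrableZl.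
apply: le_integrable => //.
  by apply/measurable_EFinP; apply: measurable_funTS; exact: measurable_expR_ln.
move=> t; rewrite /= in_itv/= andbT => t0.
have t1 : 0 < 1 + t by lra.
rewrite !lee_fin fE// mulrA divfK ?gt_eqF// -expRD.
rewrite !ger0_norm ?expR_ge0// ler_expR.
have := ln_le_affine q0 c0 t1; rewrite /K /q; lra.
Qed.

(** The rate [c] is a parameter because the Fubini argument multiplies two such kernels, and the
    variable of one is the rate of the other. *)
Definition gker s c t : R[i] := cpow t (s - 1) * (expR (- (c * t)))%:C.

Definition rGamma x : R := \int[mu]_(t in P) expR ((x - 1) * ln t - t).

Lemma gkerE s c t : gker s c t =
  cexp (((complex.Re s - 1) * ln t - c * t) +i* (complex.Im s * ln t)).
Proof.
rewrite /gker /cpow -cexpr -cexpD; congr cexp; case: s => p q.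
by apply/eqP; rewrite eq_complex/=; apply/andP; split; apply/eqP; ring.
Qed.

Lemma measurable_gker_Re s c : measurable_fun setT (fun t => complex.Re (gker s c t)).
Proof.
under eq_fun do rewrite gkerE Re_cexp/=.
apply: measurable_funM; first exact: measurable_expR_ln.
apply: measurableT_comp; first by apply: continuous_measurable_fun; exact: continuous_cos.
by apply: measurable_funM => //; exact: measurable_ln.
Qed.

Lemma measurable_gker_Im s c : measurable_fun setT (fun t => complex.Im (gker s c t)).
Proof.
under eq_fun do rewrite gkerE Im_cexp/=.
apply: measurable_funM; first exact: measurable_expR_ln.
apply: measurableT_comp; first by apply: continuous_measurable_fun; exact: continuous_sin.
by apply: measurable_funM => //; exact: measurable_ln.
Qed.

Lemma cintegrable_gker s c : 0 < complex.Re s -> 0 < c -> cintegrable mu P (gker s c).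
Proof.
move=> s0 c0; apply: (@eq_cintegrable _ (measurableTypeR R) R mu P mP (fun t =>
  cexp (((complex.Re s - 1) * ln t - c * t) +i* (complex.Im s * ln t)))) => //.
  by move=> t _; rewrite gkerE.
apply: cintegrable_cexp => //=.
- apply: measurable_funTS; apply: measurable_funB; last exact: measurable_funM.
  by apply: measurable_funM => //; exact: measurable_ln.
- by apply: measurable_funTS; apply: measurable_funM => //; exact: measurable_ln.
- by apply: integrable_expR_ln => //; lra.
Qed.

Lemma Gamma_gker s : Gamma s = cintegral mu P (gker s 1).
Proof. by apply: eq_cintegral => t _; rewrite /gker mul1r. Qed.

(** The kernel of rate [c] is [c ^ (1 - s)] times the kernel of rate 1 at [c * t], and the change of
    variables supplies the remaining factor [c ^ -1]. *)
Lemma cintegral_gker s c : 0 < complex.Re s -> 0 < c ->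
  cintegral mu P (gker s c) = cpow c (- s) * Gamma s.
Proof.
move=> s0 c0.
rewrite (@eq_cintegral _ (measurableTypeR R) R mu P _
  (fun t => cpow c (1 - s) * gker s 1 (c * t))); last first.
  move=> t /mem_pos t0; rewrite /gker mul1r cpowM// mulrA mulrA -cpowD.
  by rewrite addrA subrK subrr /cpow mul0r (_ : 0 = 0%:C)// cexpr expR0 mul1r.
rewrite (cintegralZl mP); last first.
  apply: (@eq_cintegrable _ (measurableTypeR R) R mu P mP
    (fun t => cpow c (s - 1) * gker s c t)).
    by move=> t /mem_pos t0; rewrite /gker mul1r cpowM// mulrA.
  by apply: cintegrableZl => //; exact: cintegrable_gker.
have -> : cintegral mu P (fun t => gker s 1 (c * t)) = c^-1%:C * Gamma s.
  rewrite /cintegral (Rintegral_pos_scale c0 (measurable_gker_Re s 1)).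
  rewrite (Rintegral_pos_scale c0 (measurable_gker_Im s 1)) Gamma_gker /cintegral.
  by apply/eqP; rewrite eq_complex/=; apply/andP; split; apply/eqP; ring.
rewrite mulrA addrC cpowD cpow1//; congr (_ * _).
by rewrite -mulrA -rmorphM/= mulfV ?gt_eqF// mulr1.
Qed.

Lemma Rintegral_expR_ln x c : 0 < x -> 0 < c ->
  \int[mu]_(t in P) expR ((x - 1) * ln t - c * t) = expR (- (x * ln c)) * rGamma x.
Proof.
move=> x0 c0; have cE : c^-1 = expR (- ln c) by rewrite expRN lnK.
have := Rintegral_pos_scale c0 (measurable_expR_ln (x - 1) 1).
rewrite (@eq_Rintegral _ (measurableTypeR R) R mu P
  (fun t => expR ((x - 1) * ln c) * expR ((x - 1) * ln t - c * t))); last first.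
  by move=> t /mem_pos t0; rewrite -expRD lnM ?posrE//; congr expR; ring.
rewrite RintegralZl//; last by apply: integrable_expR_ln => //; lra.
under [X in _ = _ * X -> _]eq_Rintegral do rewrite mul1r.
rewrite -/(rGamma x) => h.
apply: (mulfI (lt0r_neq0 (expR_gt0 ((x - 1) * ln c)))); rewrite h mulrA cE -expRD.
by congr (expR _ * _); ring.
Qed.

(** Only [[1, 2]] is kept, an interval of length 1 on which the exponent is at least
    [- |x - 1| * ln 2 - 2], whatever the sign of [x - 1]. *)
Lemma rGamma_gt0 x : 0 < x -> 0 < rGamma x.
Proof.
move=> x0; pose m : R := expR (- `|x - 1| * ln 2 - 2).
have mE : measurable (`[1, 2]%classic : set R) by exact: measurable_itv.
have EP : `[1, 2]%classic `<=` P.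
  by move=> t; rewrite /= !in_itv/= andbT => /andP[+ _]; exact: lt_le_trans.
have intx : mu.-integrable P (fun t => (expR ((x - 1) * ln t - t))%:E).
  have -> : (fun t => (expR ((x - 1) * ln t - t))%:E) =
    (fun t => (expR ((x - 1) * ln t - 1 * t))%:E).
    by apply/funext => t; rewrite mul1r.
  by apply: integrable_expR_ln => //; lra.
apply: (@lt_le_trans _ _ m); first exact: expR_gt0.
rewrite -lee_fin /rGamma /Rintegral fineK; last exact: integrable_fin_num.
apply: (@le_trans _ _ (\int[mu]_(t in `[1%R, 2%R]) (expR ((x - 1) * ln t - t))%:E)%E).
  have -> : (m%:E = \int[mu]_(t in `[1%R, 2%R]) (cst m%:E t))%E.
    rewrite integral_cst//= lebesgue_measure_itv/= lte_fin ltr1n.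
    by rewrite -EFinB -EFinM (_ : 2 - 1 = 1) ?mulr1//; ring.
  apply: ge0_le_integral => //.
  - by move=> t _; rewrite lee_fin expR_ge0.
  - by move: intx => /measurable_int; apply: measurable_funS.
  - move=> t; rewrite /= in_itv/= => /andP[t1 t2]; rewrite lee_fin ler_expR.
    have l0 : 0 <= ln t by exact: ln_ge0.
    have l2 : ln t <= ln 2 by rewrite ler_ln ?posrE//; lra.
    have : `|(x - 1) * ln t| <= `|x - 1| * ln 2.
      by rewrite normrM (ger0_norm l0) ler_wpM2l.
    by rewrite ler_norml => /andP[+ _]; lra.
by apply: ge0_subset_integral => //; exact: measurable_int intx.
Qed.

Lemma Gamma_re x : Gamma x%:C = (rGamma x)%:C.
Proof.
rewrite Gamma_gker /cintegral -complexr0 /rGamma; congr (_ +i* _).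
- by apply: eq_Rintegral => t _; rewrite gkerE Re_cexp/= mul0r cos0 mulr1 mul1r.
- rewrite (@eq_Rintegral _ (measurableTypeR R) R mu P (cst 0)); last first.
    by move=> t _; rewrite gkerE Im_cexp/= mul0r sin0 mulr0.
  by rewrite Rintegral_cst// mul0r.
Qed.

End GammaKernel.

(** * The functional equation of Gamma *)

Section GammaSucc.
Context (R : realType).
Local Notation mu := (@lebesgue_measure R).
Local Notation P := (`]0%R, +oo[%classic : set R).
Implicit Types (a c t x : R) (s : R[i]).

Let mP : measurable (P : set (measurableTypeR R)).
Proof. exact: measurable_itv. Qed.

(* The phases [th = 0] and [th = pi / 2] give the real and imaginary parts of
   [t^(p+iq) exp(-t)]. *)
Let F (p q th t : R) : R := expR (p * ln t - t) * cos (q * ln t - th).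
Let f (p q th t : R) : R := expR (p * ln t - t) *
  ((p * t^-1 - 1) * cos (q * ln t - th) - q * t^-1 * sin (q * ln t - th)).

Let dF p q th t : 0 < t -> is_derive t 1 (F p q th) (f p q th t).
Proof.
move=> t0.
have d1 : is_derive t 1 (fun t : R => p * ln t - t) (p * t^-1 - 1).
  exact: (is_deriveB (is_deriveZ p (is_derive1_ln t0)) (is_derive_id t 1)).
have d2 : is_derive t 1 (fun t : R => q * ln t - th) (q * t^-1 - 0).
  exact: (is_deriveB (is_deriveZ q (is_derive1_ln t0)) (is_derive_cst th t 1)).
have e := @is_derive1_comp R (@expR R) (fun t : R => p * ln t - t) t _ _ (is_derive_expR _) d1.
have c := @is_derive1_comp R (@cos R) (fun t : R => q * ln t - th) t _ _ (is_derive_cos _) d2.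
have D := is_deriveM e c.
by apply: (is_derive_eq D); rewrite /f /GRing.scale /=; ring.
Qed.

Let cf p q th t : 0 < t -> {for t, continuous (f p q th)}.
Proof.
move=> t0.
have cl r : {for t, continuous (fun t : R => r * ln t)}.
  by apply: continuousM; [exact: cst_continuous|exact: continuous_ln].
have ci r : {for t, continuous (fun t : R => r * t^-1)}.
  apply: continuousM; first exact: cst_continuous.
  by apply: continuousV; [rewrite gt_eqF|exact: cvg_id].
have c2 : {for t, continuous (fun t : R => q * ln t - th)}.
  by apply: continuousB; [exact: cl|exact: cst_continuous].
apply: continuousM.
  apply: (@continuous_comp _ _ _ (fun t : R => p * ln t - t) (@expR R)).
    by apply: continuousB; [exact: cl|exact: cvg_id].
  exact: continuous_expR.
apply: continuousB; apply: continuousM.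
- by apply: continuousB; [exact: ci|exact: cst_continuous].
- by apply: (@continuous_comp _ _ _ _ (@cos R)) => //; exact: continuous_cos.
- exact: ci.
- by apply: (@continuous_comp _ _ _ _ (@sin R)) => //; exact: continuous_sin.
Qed.

Let FB p q th t : - expR (p * ln t - t) <= F p q th t <= expR (p * ln t - t).
Proof.
rewrite -ler_norml /F normrM ger0_norm ?expR_ge0//.
by rewrite ler_piMr ?expR_ge0// cos_max.
Qed.

Let F0 p q th : 0 < p -> F p q th x @[x --> 0^'+] --> 0.
Proof.
move=> p0.
have h : expR (p * ln x - x) @[x --> 0^'+] --> 0.
  apply: (@squeeze_cvgr _ _ _ _ (cst 0) (fun x => x `^ p)).
  - near=> x; rewrite expR_ge0/= /powR gt_eqF ?ler_expR; last by near: x; exact: nbhs_right_gt.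
    by rewrite gerBl; near: x; exact: nbhs_right_ge.
  - exact: cvg_cst.
  - exact: powR_cvg0.
apply: (@squeeze_cvgr _ _ _ _ (fun x => - expR (p * ln x - x))
  (fun x => expR (p * ln x - x))) => //.
- by near=> x; exact: FB.
- by rewrite -[X in _ --> X]oppr0; exact: cvgN.
Unshelve. all: by end_near. Qed.

Let Fy p q th : 0 < p -> F p q th x @[x --> +oo] --> 0.
Proof.
(* The tangent bound with rate [1/2] absorbs the power [x ^ p] into half of the decay and leaves
   [expR (K - x / 2)]. *)
move=> p0; pose K : R := p * ln (p / 2^-1) - p.
have h : expR (p * ln x - x) @[x --> +oo] --> 0.
  apply: (@squeeze_cvgr _ _ _ _ (cst 0) (fun x => expR K * expR (- (2^-1 * x)))).
  - near=> x; rewrite expR_ge0/= -expRD ler_expR.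
    have x0 : 0 < x by near: x; exact: nbhs_pinfty_gt.
    have := @ln_le_affine R p 2^-1 x p0 _ x0; rewrite -/K => /(_ ltac:(lra)); lra.
  - exact: cvg_cst.
  - rewrite -(mulr0 (expR K)); apply: cvgM; first exact: cvg_cst.
    apply: (@cvg_comp _ _ _ (fun x : R => 2^-1 * x) (fun y => expR (- y)) _ +oo).
      by apply: gt0_cvgMry => //; exact: cvg_id.
    exact: cvgr_expR.
apply: (@squeeze_cvgr _ _ _ _ (fun x => - expR (p * ln x - x))
  (fun x => expR (p * ln x - x))) => //.
- by near=> x; exact: FB.
- by rewrite -[X in _ --> X]oppr0; exact: cvgN.
Unshelve. all: by end_near. Qed.

Let intf0 p q th : 0 < p -> mu.-integrable P (EFin \o f p q th) ->
  \int[mu]_(t in P) f p q th t = 0.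
Proof.
move=> p0 intf; rewrite -[RHS](subrr 0).
by apply: FTC_pos intf _ _ (F0 q th p0) (Fy q th p0) => t t0; [exact: dF|exact: cf].
Qed.

(** The difference of the two integrands is the derivative of [t ^ s * exp(-t)], which tends to 0 at
    both ends of the half-line because [0 < Re s]. *)
Lemma GammaS s : 0 < complex.Re s -> Gamma (s + 1) = s * Gamma s.
Proof.
move=> s0.
have i1 : cintegrable mu P (fun t => s * gker s 1 t).
  by apply: cintegrableZl => //; exact: cintegrable_gker.
have i2 : cintegrable mu P (gker (s + 1) 1).
  by apply: cintegrable_gker => //; case: s s0 {i1} => a b /=; lra.
apply/eqP; rewrite eq_sym -subr_eq0 !Gamma_gker -cintegralZl//; last exact: cintegrable_gker.
rewrite -cintegralB//.
have [p [q sE]] : exists p q, s = p +i* q by case: s {s0 i1 i2} => p q; exists p, q.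
rewrite sE/= in s0.
have h t : t \in P -> s * gker s 1 t - gker (s + 1) 1 t = f p q 0 t +i* f p q (pi / 2) t.
  move=> /mem_pos t0; rewrite /f !cosBpihalf !sinBpihalf subr0 !gkerE sE/= /cexp/= addr0 !mul1r.
  have -> : p * ln t - t = ((p - 1) * ln t - t) + ln t by ring.
  have -> : (p + 1 - 1) * ln t - t = ((p - 1) * ln t - t) + ln t by ring.
  have -> : expR ((p - 1) * ln t - t + ln t) = expR ((p - 1) * ln t - t) * t.
    by rewrite expRD lnK.
  apply/eqP; rewrite eq_complex/=; apply/andP.
  by split; apply/eqP; field; rewrite gt_eqF.
rewrite (@eq_cintegral _ (measurableTypeR R) R mu P _ _ h) /cintegral.
have [i3 i4] := @eq_cintegrable _ (measurableTypeR R) R mu P mP _ _ h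
  (@cintegrableB _ (measurableTypeR R) R mu P mP _ _ i1 i2).
by rewrite !intf0.
Qed.

End GammaSucc.

(** * Nonvanishing of Gamma on the right half-plane *)

Section GammaNeq0.
Context (R : realType).
Local Notation mu := (@lebesgue_measure R).
Local Notation P := (`]0%R, +oo[%classic : set R).
Implicit Types (a c t x : R) (s : R[i]).

Let mP : measurable (P : set (measurableTypeR R)). Proof. exact: measurable_itv. Qed.

Lemma norm_sin_le x : `|sin x| <= `|x|.
Proof.
wlog x0 : x / 0 <= x => [h|].
  have [|/ltW x0] := leP 0 x; first exact: h.
  by rewrite -normrN -sinN -(normrN x); apply: h; rewrite oppr_ge0.
have [c _] : exists2 c, c \in `[0, x]%R & sin x - sin 0 = cos c * (x - 0).
  apply: MVT_segment => //; last first.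
    by apply: continuous_subspaceT; exact: continuous_sin.
by rewrite sin0 !subr0 => ->; rewrite normrM ler_piMl// cos_max.
Qed.

(** Half-angle formula: [cos x = 1 - 2 * sin (x / 2) ^ 2], combined with [|sin y| <= |y|]. *)
Lemma cos_ge_sqr x : 1 - x ^+ 2 / 2 <= cos x.
Proof.
pose y : R := x / 2.
have -> : x = y *+ 2 by rewrite mulr2n /y; field.
have h : sin y ^+ 2 <= y ^+ 2.
  by rewrite -(ler_sqrt (sin y ^+ 2)) ?sqr_ge0// !sqrtr_sqr norm_sin_le.
rewrite cos_mulr2n cos2sin2 !mulr2n.
have -> : (y + y) ^+ 2 / 2 = y ^+ 2 + y ^+ 2 by field.
by lra.
Qed.

(** With [h = ln x / 2], the bracket is [(expR h - expR (- h)) ^ 2], so the claim is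
    [|h| <= |expR h - expR (- h)|]. The generous factor 4 lets [expR u >= 1 + u] suffice. *)
Lemma sqr_ln_le x : 0 < x -> ln x ^+ 2 <= 4 * (x - 2 + x^-1).
Proof.
move=> x0.
pose h : R := ln x / 2.
have -> : ln x = h *+ 2 by rewrite mulr2n /h; field.
have -> : x = expR h ^+ 2 by rewrite expr2 -expRD -[LHS](lnK x0) /h; congr expR; field.
have e0 := expR_gt0 h.
have -> : 4 * (expR h ^+ 2 - 2 + (expR h ^+ 2)^-1) = (expR h - expR (- h)) ^+ 2 *+ 4.
  by rewrite expRN; field; rewrite gt_eqF.
have -> : (h *+ 2) ^+ 2 = h ^+ 2 *+ 4 by ring.
rewrite lerMn2r/= -(ler_sqrt (h ^+ 2)) ?sqr_ge0// !sqrtr_sqr.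
have [h0|h0] := leP 0 h.
- rewrite ger0_norm//; apply: le_trans (ler_norm _).
  have := expR_ge1Dx h; have : expR (- h) <= 1 by rewrite expR_le1; lra.
  lra.
- rewrite ltr0_norm// distrC; apply: le_trans (ler_norm _).
  have := expR_ge1Dx (- h); have : expR h <= 1 by rewrite expR_le1; lra.
  lra.
Qed.

Lemma rGammaS x : 0 < x -> rGamma (x + 1) = x * rGamma x.
Proof.
move=> x0; apply: complexI; rewrite -Gamma_re rmorphD GammaS// Gamma_re.
by rewrite -rmorphM.
Qed.

(** Under the Gamma weight of exponent [p], the quantity [t / p - 2 + p / t] has mean [1 / (p - 1)].
    The lower bound for the integral of [C] is thus [rGamma (p - 1) * (p - 1 - 2 * q ^ 2)], whose
    positivity is the hypothesis, whereas a zero of Gamma makes that integral vanish. *)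
Lemma Gamma_neq0_large s : 1 + 2 * complex.Im s ^+ 2 < complex.Re s -> Gamma s != 0.
Proof.
case: s => p q /= pq; apply/eqP => G0.
have q2 : 0 <= q ^+ 2 by exact: sqr_ge0.
have p1 : 1 < p by lra.
pose E a t : R := expR (a * ln t - t).
have intE a : -1 < a -> mu.-integrable P (EFin \o E a).
  move=> a1; have -> : EFin \o E a = (fun t => (expR (a * ln t - 1 * t))%:E).
    by apply/funext => t; rewrite mul1r.
  exact: integrable_expR_ln.
have [intRe intIm] : cintegrable mu P (gker (p +i* q) 1).
  by apply: cintegrable_gker => //=; lra.
have [r0 i0] : \int[mu]_(t in P) complex.Re (gker (p +i* q) 1 t) = 0 /\
    \int[mu]_(t in P) complex.Im (gker (p +i* q) 1 t) = 0.
  by move: G0; rewrite Gamma_gker => -[].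
(* [C t] is [t^(p-1) exp(-t) cos(q ln(t/p))]; bounding the cosine by
   [1 - 2 q^2 (t/p - 2 + p/t)] makes the integral explicit. *)
pose C t : R := cos (q * ln p) * complex.Re (gker (p +i* q) 1 t) +
  sin (q * ln p) * complex.Im (gker (p +i* q) 1 t).
have intC1 := integrableZl mP (cos (q * ln p)) intRe.
have intC2 := integrableZl mP (sin (q * ln p)) intIm.
have intC : mu.-integrable P (EFin \o C) by exact: (integrableD mP intC1 intC2).
have C0 : \int[mu]_(t in P) C t = 0.
  by rewrite RintegralD// !RintegralZl// r0 i0 !mulr0 addr0.
have CE t : 0 < t -> C t = E (p - 1) t * cos (q * ln (t / p)).
  move=> t0; rewrite /C !gkerE Re_cexp Im_cexp /= /E mul1r ln_div ?posrE//; last by lra.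
  by rewrite mulrBr cosB; ring.
pose L t : R := (1 + 4 * q ^+ 2) * E (p - 1) t -
  ((2 * q ^+ 2 / p) * E p t + (2 * q ^+ 2 * p) * E (p - 2) t).
have intZ k a : -1 < a -> mu.-integrable P (fun t => (k * E a t)%:E).
  by move=> a1; exact: (integrableZl mP k (intE a a1)).
have intD : mu.-integrable P (fun t =>
    ((2 * q ^+ 2 / p) * E p t + (2 * q ^+ 2 * p) * E (p - 2) t)%:E).
  by apply: (integrableD mP (intZ _ _ _) (intZ _ _ _)); lra.
have intL : mu.-integrable P (EFin \o L).
  by apply: (integrableB mP (intZ _ _ _) intD); lra.
have LC t : P t -> L t <= C t.
  rewrite /= in_itv/= andbT => t0.
  have tp : 0 < t / p by apply: divr_gt0 => //; lra.
  have Ep : E p t = E (p - 1) t * t.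
    by rewrite /E -[X in _ = _ * X](lnK t0) -expRD; congr expR; ring.
  have Em : E (p - 2) t = E (p - 1) t * t^-1.
    by rewrite /E -[X in _ = _ * X^-1](lnK t0) -expRN -expRD; congr expR; ring.
  rewrite CE// /L Ep Em.
  have -> : (1 + 4 * q ^+ 2) * E (p - 1) t - ((2 * q ^+ 2 / p) * (E (p - 1) t * t) +
    (2 * q ^+ 2 * p) * (E (p - 1) t * t^-1)) = E (p - 1) t *
    (1 - q ^+ 2 * (4 * (t / p - 2 + (t / p)^-1)) / 2).
    by field; rewrite !gt_eqF//; lra.
  apply: ler_wpM2l; first exact: expR_ge0.
  apply: le_trans (cos_ge_sqr _); rewrite exprMn lerD2l lerN2 ler_pM2r//.
  by apply: ler_wpM2l => //; exact: sqr_ln_le.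
have := le_Rintegral mP intL intC LC; rewrite C0.
rewrite RintegralB//; last by apply: intZ; lra.
rewrite RintegralD//; [|by apply: intZ; lra|by apply: intZ; lra].
rewrite !RintegralZl//; try (by apply: intE; lra).
have p2 : 0 < p - 1 by lra.
have -> : \int[mu]_(t in P) E (p - 2) t = rGamma (p - 1).
  by rewrite /rGamma (_ : p - 1 - 1 = p - 2)//; ring.
have -> : \int[mu]_(t in P) E (p - 1) t = (p - 1) * rGamma (p - 1).
  by rewrite -rGammaS// subrK.
have -> : \int[mu]_(t in P) E p t = p * ((p - 1) * rGamma (p - 1)).
  rewrite -rGammaS// subrK -rGammaS; last by lra.
  by rewrite /rGamma addrK.
have := rGamma_gt0 p2; set G := rGamma _ => Gp.
have -> : (1 + 4 * q ^+ 2) * ((p - 1) * G) - (2 * q ^+ 2 / p * (p * ((p - 1) * G)) +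
  2 * q ^+ 2 * p * G) = G * (p - 1 - 2 * q ^+ 2).
  by field; rewrite gt_eqF//; lra.
by rewrite pmulr_rle0//; lra.
Qed.

Lemma Gamma_neq0 s : 0 < complex.Re s -> Gamma s != 0.
Proof.
move=> s0; apply/eqP => G0.
have ReD n : complex.Re (s + n%:R) = complex.Re s + n%:R.
  by rewrite raddfD/= -(rmorph_nat (real_complex R)).
have ImD n : complex.Im (s + n%:R) = complex.Im s.
  by rewrite raddfD/= -(rmorph_nat (real_complex R)) /= addr0.
have Gn n : Gamma (s + n%:R) = 0.
  elim: n => [|n IHn]; first by rewrite addr0.
  rewrite -natr1 addrA GammaS ?IHn ?mulr0// ReD.
  by rewrite ltr_wpDr.
have [n hn] : exists n : nat, 1 + 2 * complex.Im s ^+ 2 < n%:R.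
  exists (Num.bound (1 + 2 * complex.Im s ^+ 2)).
  by rewrite archi_boundP// addr_ge0// mulr_ge0// sqr_ge0.
have := @Gamma_neq0_large (s + n%:R); rewrite Gn eqxx ReD ImD.
by move=> /(_ _)/negP; apply=> //; lra.
Qed.

End GammaNeq0.

(** * Fubini on the quadrant and the Mellin transform of a shifted power *)

Section MellinPower.
Context (R : realType).
Local Notation mu := (@lebesgue_measure R).
Local Notation P := (`]0%R, +oo[%classic : set R).
Local Notation TR := (measurableTypeR R).

Let mP : measurable (P : set TR). Proof. exact: measurable_itv. Qed.

(** Fubini is applied on the whole plane to functions extended by zero outside the quadrant;
    integrating out a variable yields a zero extension again. *)
Let inner1 (k : R -> R -> \bar R) x :
  (\int[mu]_y ((fun u : TR * TR => k u.1 u.2) \_ (P `*` P)) (x, y) =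
   ((fun x => \int[mu]_(y in P) k x y) \_ P) x)%E.
Proof.
rewrite patchE; case: ifPn => xP.
- rewrite [RHS]integral_mkcond; apply: eq_integral => y _.
  by rewrite !patchE in_setX xP.
- rewrite -[RHS](integral0 mu setT); apply: eq_integral => y _.
  by rewrite patchE in_setX (negbTE xP).
Qed.

Let inner2 (k : R -> R -> \bar R) y :
  (\int[mu]_x ((fun u : TR * TR => k u.1 u.2) \_ (P `*` P)) (x, y) =
   ((fun y => \int[mu]_(x in P) k x y) \_ P) y)%E.
Proof.
rewrite patchE; case: ifPn => yP.
- rewrite [RHS]integral_mkcond; apply: eq_integral => x _.
  by rewrite !patchE in_setX yP andbT.
- rewrite -[RHS](integral0 mu setT); apply: eq_integral => x _.
  by rewrite patchE in_setX (negbTE yP) andbF.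
Qed.

(** By Tonelli, one finite iterated integral of the majorant makes [f] integrable for the product
    measure. Integrability of the slices ensures that the real-valued inner integrals agree with the
    extended ones. *)
Lemma Fubini_pos (f M : R -> R -> R) :
  measurable_fun [set: TR * TR] (fun u => f u.1 u.2) ->
  (forall x y, 0 < x -> 0 < y -> `|f x y| <= M x y) ->
  (forall x, 0 < x -> mu.-integrable P (fun y => (f x y)%:E)) ->
  (forall y, 0 < y -> mu.-integrable P (fun x => (f x y)%:E)) ->
  (forall y, 0 < y -> mu.-integrable P (fun x => (M x y)%:E)) ->
  mu.-integrable P (fun y => (\int[mu]_(x in P) M x y)%:E) ->
  mu.-integrable P (fun x => (\int[mu]_(y in P) f x y)%:E) /\
  \int[mu]_(x in P) \int[mu]_(y in P) f x y =
  \int[mu]_(y in P) \int[mu]_(x in P) f x y.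
Proof.
move=> mf fM if1 if2 iM iiM.
pose g := (fun u : TR * TR => (f u.1 u.2)%:E) \_ (P `*` P).
have mg : measurable_fun setT g.
  apply/(measurable_restrictT _ _).1; first exact: measurableX.
  by apply: measurable_funTS; exact/measurable_EFinP.
have ig : (mu \x mu)%E.-integrable setT g.
  apply/(integrable21ltyP mu mu mg).
  have gE y : (\int[mu]_x `|g (x, y)| =
      ((fun y => \int[mu]_(x in P) `|f x y|%:E) \_ P) y)%E.
    rewrite -(inner2 (fun x y => `|f x y|%:E)); apply: eq_integral => x _.
    by rewrite /g !patchE; case: ifP => //; rewrite abse0.
  have iM' := (integrable_mkcond _ mP).1 iiM.
  apply: (@le_lt_trans _ _
      (\int[mu]_y ((fun y => (\int[mu]_(x in P) M x y)%:E) \_ P) y)%E); last first.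
    exact: integrable_lty iM'.
  apply: ge0_le_integral => //.
  - by move=> y _; exact: integral_ge0.
  - apply: (@measurable_fun_fubini_tonelli_G _ _ _ _ R mu (abse \o g)) => //.
    + exact: measurableT_comp.
    + by move=> u; exact: abse_ge0.
  - exact: measurable_int iM'.
  - move=> y _; rewrite gE !patchE; case: ifPn => // /mem_pos y0.
    rewrite /Rintegral fineK; last by apply: integrable_fin_num => //; exact: iM.
    apply: ge0_le_integral => //.
    + by have /integrable_abse/measurable_int := if2 y y0.
    + exact: measurable_int (iM y y0).
    + by move=> x /mem_set/mem_pos x0; rewrite lee_fin; exact: fM.
have FE := Fubini ig.
have gE1 x : (\int[mu]_y g (x, y) =
   ((fun x => (\int[mu]_(y in P) f x y)%:E) \_ P) x)%E.
  rewrite /g (inner1 (fun x y => (f x y)%:E)) !patchE; case: ifPn => // /mem_pos x0.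
  by rewrite /Rintegral fineK//; apply: integrable_fin_num => //; exact: if1.
have gE2 y : (\int[mu]_x g (x, y) =
   ((fun y => (\int[mu]_(x in P) f x y)%:E) \_ P) y)%E.
  rewrite /g (inner2 (fun x y => (f x y)%:E)) !patchE; case: ifPn => // /mem_pos y0.
  by rewrite /Rintegral fineK//; apply: integrable_fin_num => //; exact: if2.
split.
- have := integrable_fubini_F ig.
  rewrite /fubini_F; under eq_fun do rewrite gE1.
  by move=> h; apply/(integrable_mkcond _ mP).
- rewrite /Rintegral; congr fine.
  rewrite [LHS]integral_mkcond [RHS]integral_mkcond.
  by under eq_integral do rewrite -gE1; under [RHS]eq_integral do rewrite -gE2.
Qed.

Lemma cFubini_pos (f : R -> R -> R[i]) (M : R -> R -> R) :
  measurable_fun [set: TR * TR] (fun u => complex.Re (f u.1 u.2)) ->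
  measurable_fun [set: TR * TR] (fun u => complex.Im (f u.1 u.2)) ->
  (forall x y, 0 < x -> 0 < y -> `|complex.Re (f x y)| <= M x y) ->
  (forall x y, 0 < x -> 0 < y -> `|complex.Im (f x y)| <= M x y) ->
  (forall x, 0 < x -> cintegrable mu P (f x)) ->
  (forall y, 0 < y -> cintegrable mu P (f ^~ y)) ->
  (forall y, 0 < y -> mu.-integrable P (fun x => (M x y)%:E)) ->
  mu.-integrable P (fun y => (\int[mu]_(x in P) M x y)%:E) ->
  cintegrable mu P (fun x => cintegral mu P (f x)) /\
  cintegral mu P (fun x => cintegral mu P (f x)) =
  cintegral mu P (fun y => cintegral mu P (f ^~ y)).
Proof.
move=> mr mi fMr fMi i1 i2 iM iiM.
have [r1 r2] := Fubini_pos mr fMr (fun x x0 => (i1 x x0).1) (fun y y0 => (i2 y y0).1) iM iiM.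
have [m1 m2] := Fubini_pos mi fMi (fun x x0 => (i1 x x0).2) (fun y y0 => (i2 y y0).2) iM iiM.
by split; [split|rewrite /cintegral r2 m2].
Qed.

Lemma Mellin_cpow (s z : R[i]) (c : R) :
  0 < complex.Re z -> 0 < complex.Re (s - z) -> 0 < c ->
  cintegrable mu P (fun v => cpow v (z - 1) * (cpow (v + c) s)^-1) /\
  cintegral mu P (fun v => cpow v (z - 1) * (cpow (v + c) s)^-1) =
  Gamma z * Gamma (s - z) / Gamma s * (cpow c (s - z))^-1.
Proof.
move=> z0 sz0 c0.
have s0 : 0 < complex.Re s by move: sz0; rewrite raddfB/=; lra.
(* On the quadrant, [A] is the logarithm of the modulus of the integrand and [B] its argument; joint
   measurability and the majorant [expR A] are read off from them. *)
pose A v t : R := ((complex.Re z - 1) * ln v - t * v) +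
  ((complex.Re s - 1) * ln t - c * t).
pose B v t : R := complex.Im z * ln v + complex.Im s * ln t.
pose f v t := gker z t v * gker s c t.
have fE v t : f v t = cexp (A v t +i* B v t) by rewrite /f !gkerE -cexpD.
have f1E v : 0 < v -> f v = (fun t => cpow v (z - 1) * gker s (v + c) t).
  move=> v0; apply/funext => t; rewrite /f /gker.
  rewrite (_ : - ((v + c) * t) = - (t * v) + - (c * t)); last by ring.
  by rewrite expRD rmorphM/=; ring.
have f2E t : f ^~ t = (fun v => gker s c t * gker z t v).
  by apply/funext => v; rewrite /f mulrC.
have mA : measurable_fun [set: TR * TR] (fun u => A u.1 u.2).
  apply: measurable_funD.
  - apply: measurable_funB; last exact: measurable_funM.
    by apply: measurable_funM => //; apply: measurableT_comp; [exact: measurable_ln|].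
  - apply: measurable_funB; last exact: measurable_funM.
    by apply: measurable_funM => //; apply: measurableT_comp; [exact: measurable_ln|].
have mB : measurable_fun [set: TR * TR] (fun u => B u.1 u.2).
  by apply: measurable_funD; apply: measurable_funM => //;
    apply: measurableT_comp => //; exact: measurable_ln.
have mr : measurable_fun [set: TR * TR] (fun u => complex.Re (f u.1 u.2)).
  under eq_fun do rewrite fE Re_cexp/=.
  apply: measurable_funM; first exact: measurableT_comp.
  by apply: measurableT_comp mB; apply: continuous_measurable_fun; exact: continuous_cos.
have mi : measurable_fun [set: TR * TR] (fun u => complex.Im (f u.1 u.2)).
  under eq_fun do rewrite fE Im_cexp/=.
  apply: measurable_funM; first exact: measurableT_comp.
  by apply: measurableT_comp mB; apply: continuous_measurable_fun; exact: continuous_sin.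
have fMr x y : 0 < x -> 0 < y -> `|complex.Re (f x y)| <= expR (A x y).
  move=> _ _; rewrite fE Re_cexp/= normrM ger0_norm ?expR_ge0//.
  by rewrite ler_piMr ?expR_ge0// cos_max.
have fMi x y : 0 < x -> 0 < y -> `|complex.Im (f x y)| <= expR (A x y).
  move=> _ _; rewrite fE Im_cexp/= normrM ger0_norm ?expR_ge0//.
  by rewrite ler_piMr ?expR_ge0// sin_max.
have i1 v : 0 < v -> cintegrable mu P (f v).
  by move=> v0; rewrite f1E//; apply: cintegrableZl => //; apply: cintegrable_gker => //; lra.
have i2 t : 0 < t -> cintegrable mu P (f ^~ t).
  by move=> t0; rewrite f2E; apply: cintegrableZl => //; exact: cintegrable_gker.
have AE v t : expR (A v t) = expR ((complex.Re s - 1) * ln t - c * t) *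
    expR ((complex.Re z - 1) * ln v - t * v).
  by rewrite /A addrC expRD.
have iM t : 0 < t -> mu.-integrable P (fun v => (expR (A v t))%:E).
  move=> t0; apply: (@eq_integrable _ TR R mu P mP
    (fun v => (expR ((complex.Re s - 1) * ln t - c * t))%:E *
       (expR ((complex.Re z - 1) * ln v - t * v))%:E)%E).
    by move=> v _; rewrite AE.
  by apply: integrableZl => //; apply: integrable_expR_ln => //; lra.
(* The inner integral turns [t ^ (Re s - 1)] into a multiple of [t ^ (Re (s - z) - 1)], so
   integrability near [t = 0] is the condition [0 < Re (s - z)]. *)
have iiM : mu.-integrable P (fun t => (\int[mu]_(v in P) expR (A v t))%:E).
  apply: (@eq_integrable _ TR R mu P mP (fun t => (rGamma (complex.Re z))%:E *
    (expR ((complex.Re (s - z) - 1) * ln t - c * t))%:E)%E); last first.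
    by apply: integrableZl => //; apply: integrable_expR_ln => //; lra.
  move=> t /mem_pos t0; under eq_Rintegral do rewrite AE.
  rewrite RintegralZl//; last by apply: integrable_expR_ln => //; lra.
  rewrite Rintegral_expR_ln// -EFinM mulrA -expRD mulrC raddfB/=; congr (expR _ * _)%:E.
  by ring.
have [iF] := cFubini_pos mr mi fMr fMi i1 i2 iM iiM.
have F1 v : v \in P -> cintegral mu P (f v) =
    Gamma s * (cpow v (z - 1) * (cpow (v + c) s)^-1).
  move=> /mem_pos v0; rewrite f1E// cintegralZl//; last first.
    by apply: cintegrable_gker => //; lra.
  by rewrite cintegral_gker ?cpowN//; [ring|lra].
have F2 t : t \in P -> cintegral mu P (f ^~ t) = Gamma z * gker (s - z) c t.
  move=> /mem_pos t0; rewrite f2E cintegralZl//; last exact: cintegrable_gker.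
  rewrite cintegral_gker// /gker (_ : s - z - 1 = (s - 1) + (- z)); last by ring.
  by rewrite [in RHS]cpowD; ring.
have Gs := Gamma_neq0 s0.
(* Fubini gives integrability only for [Gamma s] times the wanted function. The nonvanishing of
   [Gamma s] is therefore used for the existence of the integral, not just for its value. *)
have iF' := @eq_cintegrable _ TR R mu P mP _ _ F1 iF.
have iK : cintegrable mu P (fun v => cpow v (z - 1) * (cpow (v + c) s)^-1).
  apply: (@eq_cintegrable _ TR R mu P mP (fun v => (Gamma s)^-1 *
    (Gamma s * (cpow v (z - 1) * (cpow (v + c) s)^-1)))).
    by move=> v _; rewrite mulKf.
  exact: cintegrableZl.
rewrite (@eq_cintegral _ TR R mu P _ _ F1) (@eq_cintegral _ TR R mu P _ _ F2).
rewrite (cintegralZl mP _ iK) (cintegralZl mP _ (cintegrable_gker sz0 c0)).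
rewrite cintegral_gker// cpowN => h; split => //.
by apply: (mulfI Gs); rewrite h; field; rewrite Gs cpow_neq0.
Qed.

Lemma cpow_div_le (s z : R[i]) (c v : R) :
  `|complex.Re (cpow v (z - 1) * (cpow (v + c) s)^-1)| <=
    expR ((complex.Re z - 1) * ln v - complex.Re s * ln (v + c)) /\
  `|complex.Im (cpow v (z - 1) * (cpow (v + c) s)^-1)| <=
    expR ((complex.Re z - 1) * ln v - complex.Re s * ln (v + c)).
Proof.
have -> : (complex.Re z - 1) * ln v - complex.Re s * ln (v + c) =
    complex.Re ((z - 1) * (ln v)%:C + (- s) * (ln (v + c))%:C).
  by case: s z => [? ?] [? ?] /=; ring.
rewrite -cpowN /cpow -cexpD Re_cexp Im_cexp !normrM !(ger0_norm (expR_ge0 _)).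
by rewrite !ler_piMr ?expR_ge0// ?cos_max ?sin_max.
Qed.

(** The case of real exponents, meant for the majorants. What matters about [B] is that it does not
    depend on [c], so that summing over shifts leaves a series of powers. *)
Lemma Mellin_power (x q : R) : 0 < x -> x < q ->
  exists B : R, forall c, 0 < c ->
  mu.-integrable P (fun v => (expR ((x - 1) * ln v - q * ln (v + c)))%:E) /\
  \int[mu]_(v in P) expR ((x - 1) * ln v - q * ln (v + c)) =
  B * expR (- ((q - x) * ln c)).
Proof.
move=> x0 xq; pose K : R[i] := Gamma x%:C * Gamma (q%:C - x%:C) / Gamma q%:C.
exists (complex.Re K) => c c0.
have E v : cpow v (x%:C - 1) * (cpow (v + c) q%:C)^-1 =
    (expR ((x - 1) * ln v - q * ln (v + c)))%:C.
  rewrite -cpowN -(rmorph1 (real_complex R)) -rmorphB -rmorphN !cpow_re -rmorphM -expRD/=.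
  by rewrite mulNr.
have [[iM _]] := @Mellin_cpow q%:C x%:C c x0 ltac:(by rewrite raddfB/= subr_gt0) c0.
under eq_cintegral do rewrite E.
move=> h; split.
  by apply: (@eq_integrable _ TR R mu P mP _ _ _ iM) => v _; rewrite E.
rewrite -[LHS]/(complex.Re (cintegral mu P
  (fun v => (expR ((x - 1) * ln v - q * ln (v + c)))%:C))) h -/K.
rewrite -rmorphB -cpowN -rmorphN cpow_re.
by case: K {h} => k1 k2 /=; rewrite mulr0 subr0 mulNr.
Qed.

End MellinPower.

(** * Termwise integration of a dominated series *)

Section IntegralSeries.
Context d (T : measurableType d) (R : realType) (mu : {measure set T -> \bar R}).
Variables (D : set T) (mD : measurable D).

(** The partial sums are dominated by the sum [G] of the majorants, taken in the extended reals
    because it may be infinite at some points. Its integral is the sum of the integrals of the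
    [m k], hence finite. *)
Lemma Rintegral_series (F m : nat -> T -> R) (S : T -> R) :
  (forall k, mu.-integrable D (EFin \o F k)) ->
  (forall k, mu.-integrable D (EFin \o m k)) ->
  (forall k x, D x -> `|F k x| <= m k x) ->
  cvgn (series (fun k => \int[mu]_(x in D) m k x)) ->
  (forall x, D x -> series (F ^~ x) @ \oo --> S x) ->
  mu.-integrable D (EFin \o S) /\
  series (fun k => \int[mu]_(x in D) F k x) @ \oo --> \int[mu]_(x in D) S x.
Proof.
move=> iF im Fm cm FS.
have m0 k x : D x -> 0 <= m k x by move=> Dx; exact: le_trans (Fm k x Dx).
pose G x := (\sum_(k <oo) (m k x)%:E)%E.
have mm k : measurable_fun D (fun x => (m k x)%:E) by exact: measurable_int (im k).
have G0 x : D x -> (0 <= G x)%E by move=> Dx; apply: nneseries_ge0 => k _ _; rewrite lee_fin m0.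
have mG : measurable_fun D G.
  by apply: ge0_emeasurable_sum => // k x Dx _; rewrite lee_fin m0.
have iG : mu.-integrable D G.
  apply/integrableP; split => //.
  have -> : (\int[mu]_(x in D) `|G x| = \int[mu]_(x in D) G x)%E.
    by apply: eq_integral => x /set_mem Dx; rewrite gee0_abs ?G0.
  rewrite /G integral_nneseries//.
  have -> : (fun n => (\sum_(0 <= k < n) \int[mu]_(x in D) (m k x)%:E)%E) =
      EFin \o series (fun k => \int[mu]_(x in D) m k x).
    apply/funext => n; rewrite /series/= -sumEFin; apply: eq_bigr => k _.
    by rewrite /Rintegral fineK//; exact: (integrable_fin_num mD (im k)).
  by rewrite EFin_lim// ltry.
have mF n : measurable_fun D (fun x => series (F ^~ x) n).
  by apply: measurable_sum => k; apply/measurable_EFinP; exact: measurable_int (iF k).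
pose f_ n x := (series (F ^~ x) n)%:E.
have mf_ n : measurable_fun D (f_ n) by exact/measurable_EFinP.
have mS : measurable_fun D (EFin \o S).
  by apply/measurable_EFinP; exact: (measurable_fun_cvg mF).
have f_f : {ae mu, forall x, D x -> f_ ^~ x @ \oo --> (EFin \o S) x}.
  by apply/aeW => x Dx; apply: cvg_EFin; [exact: nearW|exact: FS].
have fg : {ae mu, forall x n, D x -> (`|f_ n x| <= G x)%E}.
  apply/aeW => x n Dx; apply: le_trans (nneseries_lim_ge n _); last first.
    by move=> k _ _; rewrite lee_fin m0.
  rewrite sumEFin lee_fin; apply: le_trans (ler_norm_sum _ _ _) _.
  by apply: ler_sum => k _; exact: Fm.
have [iS _ cv] := dominated_convergence mD mf_ mS f_f iG fg.
split => //.
have fS : (\int[mu]_(x in D) S x)%:E = (\int[mu]_(x in D) (EFin \o S) x)%E.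
  by rewrite /Rintegral fineK//; exact: integrable_fin_num.
apply: (@fine_cvg _ _ _ _ (fun n => (series (fun k => \int[mu]_(x in D) F k x) n)%:E)).
rewrite fS; apply: cvg_trans cv; apply: near_eq_cvg; apply: nearW => n /=.
rewrite /f_ /series/=; under eq_integral do rewrite -sumEFin.
rewrite integral_sum// -sumEFin; apply: eq_bigr => k _.
by rewrite /Rintegral fineK//; exact: (integrable_fin_num mD (iF k)).
Qed.

End IntegralSeries.

(** * Convergence of complex sequences by components *)

Section ComplexSequences.
Context (R : realType).
Implicit Types (u : nat -> R[i]) (l k : R[i]).

(** The form in which the real convergence theorems deliver their results; [ccvg_lim] converts it to
    the norm limit used by [hurwitz_zeta]. *)
Definition ccvg u l : Prop :=
  (fun n => complex.Re (u n)) @ \oo --> complex.Re l /\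
  (fun n => complex.Im (u n)) @ \oo --> complex.Im l.

Lemma ccvg_unique u l1 l2 : ccvg u l1 -> ccvg u l2 -> l1 = l2.
Proof.
case: l1 l2 => [a1 b1] [a2 b2] [/= r1 i1] [/= r2 i2].
by rewrite (cvg_unique _ r1 r2) // (cvg_unique _ i1 i2).
Qed.

Lemma ccvgZl k u l : ccvg u l -> ccvg (fun n => k * u n) (k * l).
Proof.
move=> [r i]; split.
- under eq_fun do rewrite ReM; rewrite ReM.
  by apply: cvgB; apply: cvgM => //; exact: cvg_cst.
- under eq_fun do rewrite ImM; rewrite ImM.
  by apply: cvgD; apply: cvgM => //; exact: cvg_cst.
Qed.

Lemma ccvg_lim u l : ccvg u l -> limn (u : nat -> R[i]^o) = l.
Proof.
move=> [r i]; apply/cvg_lim; first exact: norm_hausdorff.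
(* The radius [e] lies in [R[i]], where being positive forces [Im e = 0]; each component then gets
   half of [Re e]. *)
apply/cvgrPdist_lt => e; rewrite ltcE/= => /andP[/eqP ei e0].
have e2 : 0 < complex.Re e / 2 by rewrite divr_gt0.
near=> n.
have hr : `|complex.Re l - complex.Re (u n)| < complex.Re e / 2.
  by near: n; have /cvgrPdist_lt/(_ _ e2) := r.
have hi : `|complex.Im l - complex.Im (u n)| < complex.Re e / 2.
  by near: n; have /cvgrPdist_lt/(_ _ e2) := i.
have -> : l - u n = (complex.Re l - complex.Re (u n))%:C +
    'i%C * (complex.Im l - complex.Im (u n))%:C.
  by rewrite [LHS]complexE !raddfB.
apply: le_lt_trans (ler_normD _ _) _.
rewrite normrM !normc_def /= !expr0n/= !addr0 !add0r expr1n sqrtr1 mul1r !sqrtr_sqr.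
rewrite ltcE/= ei addr0 eqxx/=; lra.
Unshelve. all: by end_near. Qed.

Lemma Re_series u n : complex.Re (series u n) = series (fun j => complex.Re (u j)) n.
Proof. by rewrite /series/= raddf_sum. Qed.

Lemma Im_series u n : complex.Im (series u n) = series (fun j => complex.Im (u j)) n.
Proof. by rewrite /series/= raddf_sum. Qed.

End ComplexSequences.

(** * Convergence of the Hurwitz series *)

Section Hurwitz.
Context (R : realType).
Implicit Types (s : R[i]) (a p : R).

Lemma cvg_series_shifted_power p a : 1 < p -> 0 < a ->
  cvgn (series (fun k : nat => expR (- (p * ln (k%:R + a))))).
Proof.
move=> p1 a0; set u := (X in series X).
have u0 n : 0 <= u n by exact: expR_ge0.
apply: nondecreasing_is_cvgn; first by apply: nondecreasing_series => n _ _; exact: u0.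
pose v n : R := expR ((1 - p) * ln (n%:R + a)).
(* With [y = n + 1 + a]: [(p-1) y^(-p) <= (y-1)^(1-p) - y^(1-p)], which
   telescopes. *)
have step n : (p - 1) * u n.+1 <= v n - v n.+1.
  have x0 : 0 < n%:R + a by rewrite ltr_wpDl.
  have y0 : 0 < n.+1%:R + a by rewrite ltr_wpDl.
  set x := n%:R + a in x0 *; set y := n.+1%:R + a in y0 *.
  have xy : y = x + 1 by rewrite /x /y -natr1; ring.
  (* As [x / y - 1 = - y^-1], this gives [y^-1 <= ln y - ln x]. With [expR u >= 1 + u] it stands in
     for the comparison with an integral. *)
  have hl : ln (1 + (x / y - 1)) <= x / y - 1.
    by apply: le_ln1Dx; have : 0 < x / y by [exact: divr_gt0]; lra.
  rewrite addrC subrK ln_div ?posrE// in hl.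
  have xyE : x / y - 1 = - y^-1 by rewrite xy; field; rewrite -xy gt_eqF.
  rewrite xyE in hl.
  have uE : u n.+1 = v n.+1 * y^-1.
    rewrite /u /v -/y -[X in _ = _ * X^-1](lnK y0) -expRN -expRD; congr expR; ring.
  have vE : v n = v n.+1 * expR ((p - 1) * (ln y - ln x)).
    by rewrite /v -/y -/x -expRD; congr expR; ring.
  rewrite uE vE; set e := expR _.
  have -> : v n.+1 * e - v n.+1 = v n.+1 * (e - 1) by ring.
  rewrite mulrCA ler_wpM2l ?expR_ge0// /e.
  have h1 := expR_ge1Dx ((p - 1) * (ln y - ln x)).
  have : (p - 1) * y^-1 <= (p - 1) * (ln y - ln x) by rewrite ler_wpM2l; lra.
  by lra.
have bound n : (p - 1) * series u n.+1 <= (p - 1) * u 0%N + v 0%N - v n.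
  elim: n => [|n IHn]; first by rewrite /series/= big_nat1; lra.
  rewrite seriesSr mulrDr; have := step n; lra.
exists (u 0%N + v 0%N / (p - 1)) => _ [n _ <-].
apply: (@le_trans _ _ (series u n.+1)); first by rewrite seriesSr lerDl.
have p0 : 0 < p - 1 by lra.
rewrite -(ler_pM2l p0); apply: le_trans (bound n) _.
have : 0 <= v n by exact: expR_ge0.
by rewrite mulrDr (mulrC _ (_ / _)) divfK ?gt_eqF//; lra.
Qed.

Lemma Re_inv_cpow_le s x : `|complex.Re (cpow x s)^-1| <= expR (- (complex.Re s * ln x)).
Proof.
rewrite -cpowN /cpow Re_cexp normrM ger0_norm ?expR_ge0//.
rewrite (_ : complex.Re _ = - (complex.Re s * ln x)); last by case: s => ? ? /=; ring.
by rewrite ler_piMr ?expR_ge0// cos_max.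
Qed.

Lemma Im_inv_cpow_le s x : `|complex.Im (cpow x s)^-1| <= expR (- (complex.Re s * ln x)).
Proof.
rewrite -cpowN /cpow Im_cexp normrM ger0_norm ?expR_ge0//.
rewrite (_ : complex.Re _ = - (complex.Re s * ln x)); last by case: s => ? ? /=; ring.
by rewrite ler_piMr ?expR_ge0// sin_max.
Qed.

(** [limn] is meaningful only for a convergent series, so absolute convergence of both components is
    shown first and the limit is identified afterwards. *)
Lemma hurwitz_zeta_cvg s a : 1 < complex.Re s -> 0 < a ->
  ccvg (series (fun k : nat => (cpow (k%:R + a) s)^-1)) (hurwitz_zeta s a).
Proof.
move=> s1 a0.
have dom (v : nat -> R) : (forall k, `|v k| <= expR (- (complex.Re s * ln (k%:R + a)))) ->
    cvgn (series v).
  move=> h; apply: normed_cvg.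
  apply: (series_le_cvg _ _ h (cvg_series_shifted_power s1 a0)) => n /=.
    exact: normr_ge0.
  exact: expR_ge0.
set u := (X in series X).
have cr : cvgn (series (fun k => complex.Re (u k))) by apply: dom => k; exact: Re_inv_cpow_le.
have ci : cvgn (series (fun k => complex.Im (u k))) by apply: dom => k; exact: Im_inv_cpow_le.
have h : ccvg (series u) (limn (series (fun k => complex.Re (u k))) +i*
                          limn (series (fun k => complex.Im (u k)))).
  split => /=.
  - by under eq_fun do rewrite Re_series.
  - by under eq_fun do rewrite Im_series.
by rewrite /hurwitz_zeta (ccvg_lim h).
Qed.

End Hurwitz.

(* The first conjunct says that the integral exists (absolutely). *)
Theorem theorem2 (R : realType) (w : R) (b z : R[i])
    (hw : 0 < w) (hz : 0 < complex.Re z) (hb : 0 < complex.Re b)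
    (hbz : 0 < complex.Re (b - z)) :
  cintegrable lebesgue_measure `]0, +oo[
    (fun v : R => cpow v (z - 1) * hurwitz_zeta (b + 1) (v + w + 2^-1)) /\
  cintegral lebesgue_measure `]0, +oo[
    (fun v : R => cpow v (z - 1) * hurwitz_zeta (b + 1) (v + w + 2^-1)) =
  Gamma z * Gamma (b + 1 - z) / Gamma (b + 1) *
    hurwitz_zeta (b + 1 - z) (w + 2^-1).
Proof.
have mP : measurable (`]0, +oo[%classic : set (measurableTypeR R)).
  exact: measurable_itv.
set s := b + 1; set a := w + 2^-1; set S := (fun v : R => _ * _).
have sE : complex.Re s = complex.Re b + 1 by rewrite /s raddfD.
have szE : complex.Re (s - z) = complex.Re (b - z) + 1.
  by rewrite /s !raddfB/= raddfD/=; ring.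
have a0 : 0 < a by rewrite /a addr_gt0 // invr_gt0.
pose c (k : nat) : R := k%:R + a.
have c0 k : 0 < c k by rewrite /c ltr_wpDl.
have s1 : 1 < complex.Re s by lra.
have sz1 : 1 < complex.Re (s - z) by lra.
have sz0 : 0 < complex.Re (s - z) by lra.
pose F (k : nat) (v : R) := cpow v (z - 1) * (cpow (v + c k) s)^-1.
pose m (k : nat) (v : R) := expR ((complex.Re z - 1) * ln v - complex.Re s * ln (v + c k)).
have xq : complex.Re z < complex.Re s by move: sz1; rewrite raddfB/=; lra.
have [B mB] := Mellin_power hz xq.
(* The majorant [m k] integrates to [B * (k + a) ^ (- Re (s - z))], and [1 < Re (s - z)] makes these
   values summable. *)
have cm : cvgn (series (fun k => \int[lebesgue_measure]_(v in `]0, +oo[) m k v)).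
  have h := is_cvg_seriesZ (k := B) (cvg_series_shifted_power sz1 a0).
  rewrite (_ : (fun k => _) = (fun k => B * expR (- (complex.Re (s - z) * ln (k%:R + a)))))//.
  by apply/funext => k; rewrite (mB _ (c0 k)).2 raddfB.
have Mk k := Mellin_cpow hz sz0 (c0 k).
have FS v : 0 < v -> ccvg (series (F ^~ v)) (S v).
  move=> v0.
  have h := @hurwitz_zeta_cvg R s (v + w + 2^-1) s1 ltac:(by rewrite -addrA addr_gt0).
  have := ccvgZl (cpow v (z - 1)) h.
  rewrite (_ : (fun n => _) = series (F ^~ v))//; apply/funext => n.
  rewrite /series/= mulr_sumr; apply: eq_bigr => k _.
  by rewrite /F /c /a (_ : v + (k%:R + (w + 2^-1)) = k%:R + (v + w + 2^-1))//; ring.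
have [iSr cSr] := @Rintegral_series _ (measurableTypeR R) R lebesgue_measure _ mP
  (fun k v => complex.Re (F k v)) m (fun v => complex.Re (S v))
  (fun k => (Mk k).1.1) (fun k => (mB _ (c0 k)).1)
  (fun k v _ => (cpow_div_le s z (c k) v).1) cm
  ltac:(by move=> v; rewrite /= in_itv/= andbT => /FS[+ _]; under eq_fun do rewrite Re_series).
have [iSi cSi] := @Rintegral_series _ (measurableTypeR R) R lebesgue_measure _ mP
  (fun k v => complex.Im (F k v)) m (fun v => complex.Im (S v))
  (fun k => (Mk k).1.2) (fun k => (mB _ (c0 k)).1)
  (fun k v _ => (cpow_div_le s z (c k) v).2) cm
  ltac:(by move=> v; rewrite /= in_itv/= andbT => /FS[_ +]; under eq_fun do rewrite Im_series).
split; first by [].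
(* Both sides are limits of the series of integrals of the [F k]: the left by termwise integration,
   the right by evaluating each term with [Mellin_cpow]. *)
apply: (@ccvg_unique _ (series (fun k => cintegral lebesgue_measure `]0, +oo[ (F k)))).
  by split; [under eq_fun do rewrite Re_series|under eq_fun do rewrite Im_series].
have h := ccvgZl (Gamma z * Gamma (s - z) / Gamma s) (hurwitz_zeta_cvg sz1 a0).
rewrite (_ : series _ = (fun n => Gamma z * Gamma (s - z) / Gamma s *
  series (fun k : nat => (cpow (k%:R + a) (s - z))^-1) n))//.
apply/funext => n; rewrite /series/= mulr_sumr; apply: eq_bigr => k _.
exact: (Mk k).2.
Qed.
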